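(* (1) Let $(x^*,y^* )\in\mathbb{R}^n\times\mathbb{R}^m$ be a bi-local solution of (BP), and assume that the lower level problem $(P_{x})$ is convex at $x=x^*$ with respect to the variable $y$. Then $(x^*,y^* )$ is a local solution of (BP). (2) Conversely, let $(x^*,y^* )\in\mathbb{R}^n\times\mathbb{R}^m$ be a global or local solution of (BP) around which $f,g,h$ are continuous. If the solution mapping $x\mapsto S(x)$ of the lower level problem is continuous at $x^*$ (as a set-valued mapping), then $(x^*,y^* )$ is a bi-local solution of (BP).
   Context: Data: $F,f:\mathbb{R}^n\times\mathbb{R}^m\to\mathbb{R}$, $H:\mathbb{R}^n\times\mathbb{R}^m\to\mathbb{R}^p$, $G:\mathbb{R}^n\times\mathbb{R}^m\to\mathbb{R}^q$, $h:\mathbb{R}^n\times\mathbb{R}^m\to\mathbb{R}^r$, $g:\mathbb{R}^n\times\mathbb{R}^m\to\mathbb{R}^s$. Let $\Phi=\{(x,y): H(x,y)=0,\ G(x,y)\le 0\}$ and $Y(x)=\{y\in\mathbb{R}^m: h(x,y)=0,\ g(x,y)\le 0\}$ (vector inequalities are componentwise). The lower level problem $(P_x)$ is $\min_y f(x,y)$ s.t. $y\in Y(x)$, and $S(x)$ is its set of (global) solutions. The bilevel problem (BP) is $\min_{x,y} F(x,y)$ s.t. $H(x,y)=0$, $G(x,y)\le 0$, $y\in S(x)$; its feasible set is $\mathcal{F}=\{(x,y)\in\Phi: y\in S(x)\}$. $\boldsymbol{B}_\delta(z)$ denotes the closed Euclidean ball of radius $\delta$ centered at $z$. The problem $(P_{x^*})$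 being convex in $y$ means that $f(x^*,\cdot)$ is convex and $Y(x^* )$ is a convex set. Continuity of a set-valued mapping at a point means both inner (lower) and outer (upper) semicontinuity there. Local solution of (BP): a point $(x^*,y^* )\in\Phi$ with $y^*\in S(x^* )$ such that for some $\delta>0$, $F(x^*,y^* )\le F(x,y)$ for all $(x,y)\in\mathcal{F}\cap\boldsymbol{B}_\delta(x^*,y^* )$; it is a global solution if $\delta=\infty$ can be taken. Bi-local (optimal) solution of (BP): a point $(x^*,y^* )$ with $(x^*,y^* )\in\Phi$ and $y^*\in Y(x^* )$ for which there exist $\delta_0>0$ and a function $\eta:(0,\delta_0]\to(0,\infty)$ with $\eta(\delta)\to0$ as $\delta\to0$ such that for every $\delta\in(0,\delta_0]$: (a) $f(x^*,y^* )\le f(x^*,z)$ for all $z\in Y(x^* )\cap\boldsymbol{B}_{\eta(\delta)}(y^* )$; and (b) for every $(x,y)\in\Phi\cap[\boldsymbol{B}_\delta(x^* )\times\boldsymbol{B}_{\eta(\delta)}(y^* )]$ satisfying $y\in\operatorname{argmin}_z\{f(x,z): z\in Y(x)\cap\boldsymbol{B}_{\eta(\delta)}(y^* )\}$ one has $F(x^*,y^* )\le F(x,y)$. *)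

(* Defs.v *)
From mathcomp Require Import all_boot all_order all_algebra.
From mathcomp Require Import all_classical all_reals all_analysis.

Set Implicit Arguments.
Unset Strict Implicit.
Unset Printing Implicit Defensive.

Import Order.TTheory GRing.Theory Num.Theory.
Import numFieldNormedType.Exports.

Local Open Scope classical_set_scope.
Local Open Scope ring_scope.

(* The library norm on 'rV[R]_n and on products is the max norm: it induces the
   usual topology, but its balls are not the Euclidean ones. *)
Definition enorm (R : realType) (n : nat) (v : 'rV[R]_n) : R :=
  Num.sqrt (\sum_(i < n) v 0 i ^+ 2).

Definition eball (R : realType) (n : nat) (c : 'rV[R]_n) (d : R) :
    set 'rV[R]_n :=
  closed_ball_ (@enorm R n) c d.

(* R^n x R^m carries the Euclidean norm of R^(n + m). *)
Definition eball2 (R : realType) (n m : nat) (c : 'rV[R]_n * 'rV[R]_m)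
    (d : R) : set ('rV[R]_n * 'rV[R]_m) :=
  closed_ball_ (fun z => enorm (row_mx z.1 z.2)) c d.

Definition argmin (T : Type) (R : realType) (A : set T) (phi : T -> R) :
    set T :=
  [set y | A y /\ forall z, A z -> phi y <= phi z].

(* Painleve-Kuratowski limits of a set-valued mapping, in sequential form.
   No nonemptiness of the values is presupposed. *)
Definition outer_limit (X Y : topologicalType) (S : X -> set Y) (x0 : X) :
    set Y :=
  [set y | exists (u : nat -> X) (v : nat -> Y),
     [/\ u k @[k --> \oo] --> x0, v k @[k --> \oo] --> y
       & forall k, S (u k) (v k)]].

Definition inner_limit (X Y : topologicalType) (S : X -> set Y) (x0 : X) :
    set Y :=
  [set y | forall u : nat -> X, u k @[k --> \oo] --> x0 ->
     exists2 v : nat -> Y, v k @[k --> \oo] --> y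
       & \forall k \near \oo, S (u k) (v k)].

Definition outer_semicontinuous_at (X Y : topologicalType) (S : X -> set Y)
    (x0 : X) : Prop :=
  outer_limit S x0 `<=` S x0.

Definition inner_semicontinuous_at (X Y : topologicalType) (S : X -> set Y)
    (x0 : X) : Prop :=
  S x0 `<=` inner_limit S x0.

Definition setvalued_continuous_at (X Y : topologicalType) (S : X -> set Y)
    (x0 : X) : Prop :=
  inner_semicontinuous_at S x0 /\ outer_semicontinuous_at S x0.

Record bilevel (R : realType) (n m p q r s : nat) := Bilevel {
  upper_obj : 'rV[R]_n * 'rV[R]_m -> R;        (* F *)
  lower_obj : 'rV[R]_n * 'rV[R]_m -> R;        (* f *)
  upper_eq  : 'rV[R]_n * 'rV[R]_m -> 'rV[R]_p; (* H *)
  upper_le  : 'rV[R]_n * 'rV[R]_m -> 'rV[R]_q; (* G *)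
  lower_eq  : 'rV[R]_n * 'rV[R]_m -> 'rV[R]_r; (* h *)
  lower_le  : 'rV[R]_n * 'rV[R]_m -> 'rV[R]_s  (* g *)
}.

(* The set Phi. *)
Definition upper_set (R : realType) (n m p q r s : nat)
    (P : bilevel R n m p q r s) : set ('rV[R]_n * 'rV[R]_m) :=
  [set z | upper_eq P z = 0 /\ forall i, upper_le P z 0 i <= 0].

(* The set Y(x). *)
Definition lower_set (R : realType) (n m p q r s : nat)
    (P : bilevel R n m p q r s) (x : 'rV[R]_n) : set 'rV[R]_m :=
  [set y | lower_eq P (x, y) = 0 /\ forall i, lower_le P (x, y) 0 i <= 0].

(* The set S(x). *)
Definition lower_solutions (R : realType) (n m p q r s : nat)
    (P : bilevel R n m p q r s) (x : 'rV[R]_n) : set 'rV[R]_m :=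
  argmin (lower_set P x) (fun y => lower_obj P (x, y)).

Definition feasible (R : realType) (n m p q r s : nat)
    (P : bilevel R n m p q r s) : set ('rV[R]_n * 'rV[R]_m) :=
  [set z | upper_set P z /\ lower_solutions P z.1 z.2].

Definition lower_convex_at (R : realType) (n m p q r s : nat)
    (P : bilevel R n m p q r s) (x : 'rV[R]_n) : Prop :=
  @convex_function R 'rV[R]_m setT (fun y => lower_obj P (x, y)) /\
  @convex_set R 'rV[R]_m (lower_set P x).

Definition local_solution (R : realType) (n m p q r s : nat)
    (P : bilevel R n m p q r s) (xs : 'rV[R]_n) (ys : 'rV[R]_m) : Prop :=
  [/\ upper_set P (xs, ys), lower_solutions P xs ys
    & exists2 d : R, 0 < d & forall x y,
        (feasible P `&` eball2 (xs, ys) d) (x, y) ->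
        upper_obj P (xs, ys) <= upper_obj P (x, y)].

Definition global_solution (R : realType) (n m p q r s : nat)
    (P : bilevel R n m p q r s) (xs : 'rV[R]_n) (ys : 'rV[R]_m) : Prop :=
  [/\ upper_set P (xs, ys), lower_solutions P xs ys
    & forall x y, feasible P (x, y) ->
        upper_obj P (xs, ys) <= upper_obj P (x, y)].

(* Only the values of eta on ]0, d0] matter. *)
Definition bilocal_solution (R : realType) (n m p q r s : nat)
    (P : bilevel R n m p q r s) (xs : 'rV[R]_n) (ys : 'rV[R]_m) : Prop :=
  [/\ upper_set P (xs, ys), lower_set P xs ys
    & exists (d0 : R) (eta : R -> R),
      [/\ 0 < d0,
          forall d, 0 < d <= d0 -> 0 < eta d,
          eta d @[d --> 0^'+] --> 0
        & forall d, 0 < d <= d0 ->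
          (forall z, (lower_set P xs `&` eball ys (eta d)) z ->
             lower_obj P (xs, ys) <= lower_obj P (xs, z)) /\
          (forall x y,
             (upper_set P `&` (eball xs d `*` eball ys (eta d))) (x, y) ->
             argmin (lower_set P x `&` eball ys (eta d))
               (fun z => lower_obj P (x, z)) y ->
             upper_obj P (xs, ys) <= upper_obj P (x, y))]].

Definition continuous_around (X Y : topologicalType) (phi : X -> Y) (z0 : X) :
    Prop :=
  \forall z \near z0, {for z, continuous phi}.

(* Main.v *)
Require Import Defs.
From mathcomp Require Import all_boot all_order all_algebra.
From mathcomp Require Import all_classical all_reals all_analysis.
From mathcomp Require Import lra.

Import Order.TTheory GRing.Theory Num.Theory.
Import numFieldNormedType.Exports.

Local Open Scope classical_set_scope.
Local Open Scope ring_scope.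

(** Both implications compare minimizing the lower level objective over all of
Y(x) with minimizing it over Y(x) intersected with a ball around ys. A global
minimizer lying in the ball always minimizes over the intersection
([argmin_setI]); the two directions differ in how the converse is obtained.

From bi-local to local: at xs a minimizer over the ball is a global one by
convexity ([convex_local_argmin]), so ys belongs to S(xs). Fix a single radius
d0 and the associated eta(d0). A feasible (x, y) within min(d0, eta(d0)) of
(xs, ys) has y in S(x) and in the ball of radius eta(d0), hence is one of the
competitors of the bi-local problem.

From local to bi-local: inner semicontinuity of S at xs says that for each
e > 0 the set S(x) meets the e-ball around ys as soon as x is close to xs
([inner_limit_eball]). This gives a radius eta(d), tending to 0 with d, such
that S(x) meets the eta(d)-ball for all x within d of xs ([exists_modulus]).
For such x, minimizing over the ball yields the global minimum value, so each
restricted minimizer belongs to S(x) ([argmin_of_setI]); every competitor of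
the bi-local problem is then feasible for the bilevel problem and, once
d + eta(d) is small, close enough to (xs, ys) for local optimality to apply. *)

(** * The Euclidean norm *)

Lemma enorm_ge0 (R : realType) (n : nat) (v : 'rV[R]_n) : 0 <= enorm v.
Proof. exact: sqrtr_ge0. Qed.

Lemma sqr_enorm (R : realType) (n : nat) (v : 'rV[R]_n) :
  enorm v ^+ 2 = \sum_(i < n) v 0 i ^+ 2.
Proof. by rewrite sqr_sqrtr// sumr_ge0// => i _; rewrite sqr_ge0. Qed.

Lemma enormZ (R : realType) (n : nat) (t : R) (v : 'rV[R]_n) :
  enorm (t *: v) = `|t| * enorm v.
Proof.
apply: (@pexpIrn _ 2); rewrite ?nnegrE ?enorm_ge0 ?mulr_ge0 ?enorm_ge0//.
rewrite exprMn !sqr_enorm real_normK ?num_real// mulr_sumr.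
by apply: eq_bigr => i _; rewrite mxE exprMn.
Qed.

Lemma sqr_enorm_row_mx (R : realType) (n m : nat) (v : 'rV[R]_n)
    (w : 'rV[R]_m) :
  enorm (row_mx v w) ^+ 2 = enorm v ^+ 2 + enorm w ^+ 2.
Proof.
rewrite !sqr_enorm big_split_ord/=; congr (_ + _);
  by apply: eq_bigr => i _; rewrite (row_mxEl, row_mxEr).
Qed.

Lemma enorm_row_mx_gel (R : realType) (n m : nat) (v : 'rV[R]_n)
    (w : 'rV[R]_m) :
  enorm v <= enorm (row_mx v w).
Proof.
rewrite -(@ler_pXn2r _ 2) ?nnegrE ?enorm_ge0// sqr_enorm_row_mx.
by rewrite lerDl sqr_ge0.
Qed.

Lemma enorm_row_mx_ger (R : realType) (n m : nat) (v : 'rV[R]_n)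
    (w : 'rV[R]_m) :
  enorm w <= enorm (row_mx v w).
Proof.
rewrite -(@ler_pXn2r _ 2) ?nnegrE ?enorm_ge0// sqr_enorm_row_mx.
by rewrite lerDr sqr_ge0.
Qed.

Lemma enorm_row_mx_le (R : realType) (n m : nat) (v : 'rV[R]_n)
    (w : 'rV[R]_m) :
  enorm (row_mx v w) <= enorm v + enorm w.
Proof.
rewrite -(@ler_pXn2r _ 2) ?nnegrE ?addr_ge0 ?enorm_ge0// sqr_enorm_row_mx.
by rewrite sqrrD -addrA lerD2l lerDr mulrn_wge0// mulr_ge0 ?enorm_ge0.
Qed.

Lemma mx_norm_le_enorm (R : realType) (n : nat) (v : 'rV[R]_n) :
  `|v| <= enorm v.
Proof.
rewrite [leLHS]/Num.norm /= mx_normrE.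
apply/bigmax_leP; split; first exact: enorm_ge0.
move=> [i j] _ /=; rewrite (ord1 i) {i}.
rewrite -(@ler_pXn2r _ 2) ?nnegrE ?enorm_ge0// real_normK ?num_real//.
rewrite sqr_enorm (bigD1 j)//= lerDl sumr_ge0// => i _; exact: sqr_ge0.
Qed.

Lemma enorm_le_mx_norm (R : realType) (n : nat) (v : 'rV[R]_n) :
  enorm v <= Num.sqrt n%:R * `|v|.
Proof.
rewrite -(@ler_pXn2r _ 2) ?nnegrE ?mulr_ge0 ?enorm_ge0 ?sqrtr_ge0//.
rewrite sqr_enorm exprMn sqr_sqrtr//.
rewrite (_ : n%:R * _ = \sum_(i < n) `|v| ^+ 2); last first.
  by rewrite sumr_const card_ord mulr_natl.
apply: ler_sum => i _; rewrite -[leLHS]real_normK ?num_real//.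
rewrite ler_pXn2r ?nnegrE// [leRHS]/Num.norm /= mx_normrE.
by apply/bigmax_geP; right => /=; exists (ord0, i).
Qed.

(** Convergence is expressed with the max norm, balls with the Euclidean one;
the equivalence of the two norms lets the arguments below mix them. *)
Lemma cvg_enorm (R : realType) (n : nat) (T : Type) (F : set_system T)
    (FF : Filter F) (u : T -> 'rV[R]_n) (x : 'rV[R]_n) :
  u k @[k --> F] --> x <-> enorm (x - u k) @[k --> F] --> 0.
Proof.
split=> [ux|ux].
- apply: (squeeze_cvgr (f := cst 0)
      (h := fun k => Num.sqrt n%:R * `|x - u k|)).
  + by apply: nearW => k; rewrite enorm_ge0 enorm_le_mx_norm.
  + exact: cvg_cst.
  + rewrite -[X in _ --> X](mulr0 (Num.sqrt n%:R)).
    apply: cvgM; first exact: cvg_cst.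
    rewrite -(@normr0 _ 'rV[R]_n) -[X in `|X|](subrr x).
    by apply: cvg_norm; apply: cvgB => //; exact: cvg_cst.
- apply/cvgrPdist_le => e e0; move/cvgrPdist_le: ux => /(_ e e0).
  apply: filterS => k; rewrite sub0r normrN ger0_norm ?enorm_ge0//.
  by apply: le_trans; exact: mx_norm_le_enorm.
Qed.

(** * Minimizers over a set and over its intersection with a ball *)

Lemma argmin_setI (T : Type) (R : realType) (A B : set T) (phi : T -> R) y :
  argmin A phi y -> B y -> argmin (A `&` B) phi y.
Proof. by move=> [Ay miny] By; split=> // z [Az _]; exact: miny. Qed.

(** The point z shows that the minimum over the smaller set is already the
minimum over A. *)
Lemma argmin_of_setI (T : Type) (R : realType) (A B : set T) (phi : T -> R)
    y z :
  argmin (A `&` B) phi y -> argmin A phi z -> B z -> argmin A phi y.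
Proof.
move=> [[Ay By] miny] [Az minz] Bz; split=> // w Aw.
by rewrite (le_trans (miny z _)) ?minz.
Qed.

(** If a point z of A had a smaller value than y, then by convexity every point
of the segment from y to z other than y would be in A with a smaller value, and
some of these are within e of y. *)
Lemma convex_local_argmin (R : realType) (m : nat) (A : set 'rV[R]_m)
    (phi : 'rV[R]_m -> R) (y : 'rV[R]_m) (e : R) :
  @convex_set R 'rV[R]_m A -> @convex_function R 'rV[R]_m setT phi ->
  0 < e -> A y ->
  (forall z, (A `&` eball y e) z -> phi y <= phi z) -> argmin A phi y.
Proof.
move=> cA cphi e0 Ay miny; split=> // z Az.
set N := enorm (y - z).
have N0 : 0 <= N by exact: enorm_ge0.
have eN0 : 0 < e + N by lra.
(* With this weight, t <= 1 and t * N <= e without a case split on N = 0. *)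
pose t := e / (e + N).
have t0 : 0 < t by rewrite divr_gt0.
have t1 : t <= 1 by rewrite ler_pdivrMr// mul1r lerDl.
pose t' : {i01 R} := Itv01 (ltW t0) t1.
pose w : 'rV[R]_m := t *: z + (1 - t) *: y.
have Aw : A w.
  apply/set_mem; apply: (cA z y t'); exact/mem_set.
have Bw : eball y e w.
  rewrite /eball /closed_ball_ /= (_ : y - w = t *: (y - z)); last first.
    by apply/rowP => i; rewrite !mxE; lra.
  rewrite enormZ gtr0_norm// -/N /t mulrAC ler_pdivrMr//.
  by rewrite ler_pM2l// lerDr ltW.
have phiw : phi w <= t * phi z + (1 - t) * phi y.
  by apply: (cphi t' z y); rewrite inE.
have := miny w (conj Aw Bw) => phiyw.
have : t * phi y <= t * phi z by lra.
by rewrite ler_pM2l.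
Qed.

(** * Inner semicontinuity on balls *)

(** The sequential definition turned into a statement on balls: otherwise,
picking a bad point in the ball of radius 1 / (k + 1) for each k gives a
sequence tending to x0 along which S eventually has points near y0. *)
Lemma inner_limit_eball (R : realType) (n m : nat)
    (S : 'rV[R]_n -> set 'rV[R]_m) (x0 : 'rV[R]_n) (y0 : 'rV[R]_m) (e : R) :
  inner_limit S x0 y0 -> 0 < e ->
  exists2 d : R, 0 < d &
    forall x, eball x0 d x -> S x `&` eball y0 e !=set0.
Proof.
move=> Sy0 e0; apply: contrapT => nod.
have /choice[u uP] : forall k : nat, exists x,
    eball x0 (harmonic k) x /\ ~ (S x `&` eball y0 e !=set0).
  move=> k; apply: contrapT => nox; apply: nod.
  exists (harmonic k) => [|x xd]; first exact: harmonic_gt0.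
  by apply: contrapT => Sx; apply: nox; exists x.
have ux0 : u k @[k --> \oo] --> x0.
  apply/cvg_enorm.
  apply: (squeeze_cvgr (f := cst 0) (h := @harmonic R)).
  - by apply: nearW => k; rewrite enorm_ge0; case: (uP k).
  - exact: cvg_cst.
  - exact: cvg_harmonic.
have [v /cvg_enorm vy0 Sv] := Sy0 u ux0.
move/cvgrPdist_le: vy0 => /(_ e e0) vy0.
have [k [Svk vk]] := filter_ex (filterI Sv vy0).
have [_ []] := uP k; exists (v k); split=> //.
by move: vk; rewrite sub0r normrN ger0_norm ?enorm_ge0.
Qed.

(** Turns a statement of the form, for each e there is d, into a function
eta of d. Take for eta(d) the infimum of the admissible e, plus d: the added d
makes eta(d) positive and, Q being monotone in e, admissible even when the
infimum is not attained. The bound c serves to keep d and eta(d) within the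
radius of local optimality. *)
Lemma exists_modulus (R : realType) (Q : R -> R -> Prop) (c : R) :
  (forall d d' e, d' <= d -> Q d e -> Q d' e) ->
  (forall d e e', e <= e' -> Q d e -> Q d e') ->
  (forall e, 0 < e -> exists2 d, 0 < d & Q d e) ->
  0 < c ->
  exists (d0 : R) (eta : R -> R),
    [/\ 0 < d0, d0 <= c,
        forall d, 0 < d <= d0 -> [/\ 0 < eta d, eta d <= c & Q d (eta d)]
      & eta d @[d --> 0^'+] --> 0].
Proof.
move=> Qd Qe Qex c0.
pose E d := [set e | 0 < e /\ Q d e].
have E_lb d : has_lbound (E d) by exists 0 => e [/ltW].
have infE_ge0 d e : Q d e -> 0 < e -> 0 <= inf (E d).
  by move=> Qde e0; apply: lb_le_inf; [exists e|move=> ? [/ltW]].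
have infE_le d e : Q d e -> 0 < e -> inf (E d) <= e.
  by move=> Qde e0; apply: ge_inf.
have [d1 d10 Qd1] : exists2 d, 0 < d & Q d (c / 2) by apply: Qex; lra.
exists (Num.min d1 (c / 2)), (fun d => inf (E d) + d); split.
- by rewrite lt_min d10; lra.
- by rewrite ge_min; apply/orP; right; lra.
- move=> d /andP[d0]; rewrite le_min => /andP[dd1 dc].
  have Qdc : Q d (c / 2) by exact: Qd Qd1.
  have c20 : 0 < c / 2 by lra.
  have := infE_ge0 _ _ Qdc c20; have := infE_le _ _ Qdc c20.
  split; [lra|lra|].
  have [|e [_ Qde] /ltW/Qe] := @inf_adherent _ (E d) d d0; last exact.
  by split; [exists (c / 2)|].
- apply/cvgrPdist_le => e e0.
  have e20 : 0 < e / 2 by lra.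
  have [d2 d20 Qd2] := Qex _ e20.
  near=> d.
  have d0 : 0 < d by near: d; exact: nbhs_right_gt.
  have de : d <= e / 2 by near: d; exact: nbhs_right_le.
  have dd2 : d <= d2 by near: d; exact: nbhs_right_le.
  have Qde : Q d (e / 2) by exact: Qd Qd2.
  have := infE_ge0 _ _ Qde e20; have := infE_le _ _ Qde e20.
  by rewrite sub0r normrN => ? ?; rewrite ger0_norm; lra.
Unshelve. all: by end_near. Qed.

(** * The two implications *)

Lemma global_local_solution (R : realType) (n m p q r s : nat)
    (P : bilevel R n m p q r s) (xs : 'rV[R]_n) (ys : 'rV[R]_m) :
  global_solution P xs ys -> local_solution P xs ys.
Proof. by move=> [? ? gm]; split=> //; exists 1 => // x y [/gm]. Qed.

Lemma bilocal_solution_local (R : realType) (n m p q r s : nat)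
    (P : bilevel R n m p q r s) (xs : 'rV[R]_n) (ys : 'rV[R]_m) :
  bilocal_solution P xs ys -> lower_convex_at P xs -> local_solution P xs ys.
Proof.
move=> [Us Ls [d0 [eta [d00 eta0 _ bil]]]] [cf cY].
have d0P : 0 < d0 <= d0 by rewrite d00 lexx.
have e0 := eta0 _ d0P; have [minys Fmin] := bil _ d0P.
split=> //; first exact: convex_local_argmin cY cf e0 Ls minys.
exists (Num.min d0 (eta d0)); first by rewrite lt_min d00.
move=> x y [[Uxy Sxy]]; rewrite /eball2 /closed_ball_ /= => dxy.
have xB : eball xs d0 x.
  apply: (le_trans (enorm_row_mx_gel _ _ _ _ (ys - y))).
  by rewrite (le_trans dxy)// ge_min lexx.
have yB : eball ys (eta d0) y.
  apply: (le_trans (enorm_row_mx_ger _ _ _ (xs - x) _)).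
  by rewrite (le_trans dxy)// ge_min lexx orbT.
by apply: Fmin => //; exact: argmin_setI.
Qed.

(** Half of the radius of local optimality goes to x and half to y, since the
Euclidean norm of a pair is at most the sum of the norms. *)
Lemma local_solution_bilocal (R : realType) (n m p q r s : nat)
    (P : bilevel R n m p q r s) (xs : 'rV[R]_n) (ys : 'rV[R]_m) :
  local_solution P xs ys -> inner_semicontinuous_at (lower_solutions P) xs ->
  bilocal_solution P xs ys.
Proof.
move=> [Us Ss [d d0 Fmin]] isc.
pose Q a e := forall x, eball xs a x ->
  lower_solutions P x `&` eball ys e !=set0.
have [||e e0||d1 [eta [d10 d1d etaP eta_cvg]]] := @exists_modulus R Q (d / 2).
- by move=> a a' e a'a Qae x xa'; apply: Qae; exact: le_trans a'a.
- move=> a e e' ee' Qae x /Qae[y [Sy ye]]; exists y; split=> //.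
  exact: le_trans ee'.
- exact: inner_limit_eball (isc _ Ss) e0.
- by lra.
split=> //; first by case: Ss.
exists d1, eta; split=> // [a /etaP[]//|a /[dup] aP /etaP[_ etad Qa]].
split=> [z [Yz _]|x y [Uxy [xB yB]] miny]; first by case: Ss => _; exact.
have [z [Sz zB]] := Qa x xB.
apply: Fmin; split; first by split=> //; exact: argmin_of_setI miny Sz zB.
apply: le_trans (enorm_row_mx_le _ _ _ _ _) _ => /=.
move: xB yB; rewrite /eball /closed_ball_ /= => xB yB; move: aP => /andP[_ aP].
by lra.
Qed.

Theorem theorem2p4 (R : realType) (n m p q r s : nat)
    (P : bilevel R n m p q r s) (xs : 'rV[R]_n) (ys : 'rV[R]_m) :
  (bilocal_solution P xs ys -> lower_convex_at P xs ->
     local_solution P xs ys) /\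
  (global_solution P xs ys \/ local_solution P xs ys ->
     continuous_around (lower_obj P) (xs, ys) ->
     continuous_around (lower_le P) (xs, ys) ->
     continuous_around (lower_eq P) (xs, ys) ->
     setvalued_continuous_at (lower_solutions P) xs ->
     bilocal_solution P xs ys).
Proof.
split; first exact: bilocal_solution_local.
move=> sol _ _ _ [isc _]; apply: local_solution_bilocal => //.
by case: sol => // /global_local_solution.
Qed.
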